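(* Let $H \subseteq \binom{[n]}{4}$ be a design on $[n]$ (every pair of distinct $u \neq v \in [n]$ lies in exactly one $C \in H$), and suppose the associated design $3$-LCC has dimension $k$, i.e. the subspace $\mathcal{V} = \{x \in \mathbb{F}_2^n : \sum_{v \in C} x_v = 0 \text{ for all } C \in H\}$ has dimension $k$ over $\mathbb{F}_2$. Then $n \geq 2^{(1-o(1))\sqrt{k}}$, where the $o(1)$ term is $O(\log k/\sqrt{k})$.
   Context: A design $3$-LCC of dimension $k$ is a collection $H \subseteq \binom{[n]}{4}$ of $4$-element subsets of $[n]$ such that every pair of distinct elements of $[n]$ is contained in exactly one member of $H$, and such that the subspace $\{x \in \{0,1\}^n : \sum_{v\in C} x_v = 0 \ (\mathrm{mod}\ 2)\ \forall C \in H\}$ has dimension $k$. Asymptotics are as $k \to \infty$. *)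

(* Defs.v *)
From HB Require Import structures.
From mathcomp Require Import all_boot all_order all_algebra.
From mathcomp Require Import all_classical all_reals all_analysis.

Set Implicit Arguments.
Unset Strict Implicit.
Unset Printing Implicit Defensive.

Import Order.TTheory GRing.Theory Num.Theory.

Local Open Scope ring_scope.

Definition is_design (n : nat) (H : {set {set 'I_n}}) : Prop :=
  (forall C, C \in H -> #|C| = 4%N) /\
  (forall u v : 'I_n, u != v ->
     exists! C, C \in H /\ u \in C /\ v \in C).

(* The codomain is the regular module over 'F_2 so that [linfun] applies. *)
Definition parity (n : nat) (C : {set 'I_n}) (x : 'rV['F_2]_n) : ('F_2)^o :=
  \sum_(v in C) x 0 v.

Lemma parity_is_linear (n : nat) (C : {set 'I_n}) : linear (parity C).
Proof.
move=> a x y; rewrite /parity scaler_sumr -big_split /=.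
by apply: eq_bigr => v _; rewrite !mxE.
Qed.

HB.instance Definition _ (n : nat) (C : {set 'I_n}) :=
  GRing.isLinear.Build 'F_2 'rV['F_2]_n ('F_2)^o _ (parity C)
    (parity_is_linear C).

Definition lcc_space (n : nat) (H : {set {set 'I_n}}) :
    {vspace 'rV['F_2]_n} :=
  (\bigcap_(C in H) lker (linfun (parity C)))%VS.

Lemma mem_lcc_space (n : nat) (H : {set {set 'I_n}}) (x : 'rV['F_2]_n) :
  (x \in lcc_space H) = [forall C in H, \sum_(v in C) x 0 v == 0].
Proof.
apply/idP/forall_inP => [xV C HC|xV].
  have /subvP/(_ x xV) : (lcc_space H <= lker (linfun (parity C)))%VS.
    exact: bigcapv_inf (subvv _).
  by rewrite memv_ker lfunE.
rewrite memvE; apply/subv_bigcapP => C HC.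
by rewrite -memvE memv_ker lfunE; exact: xV.
Qed.

(* Main.v *)
Require Import Defs.
From mathcomp Require Import all_boot all_order all_algebra.
From mathcomp Require Import all_classical all_reals all_analysis.
From mathcomp Require Import ring lra.

(* A basis of the code in systematic form gives columns [v i] in [F_2^k] with
   [v i + v a = v b + v c] for every block [{i, a, b, c}] and with every unit
   vector among them.  Replacing pairs of columns one block at a time turns
   [v i + v a_1 + .. + v a_r] into [v b_1 + .. + v b_r + v w]: when the a_t are
   uniform so are the b_t, and given the b_t the point [w] is the endpoint of an
   [r]-step random walk from [i] whose [t]-th step goes from a point [x] to one
   of the two other points of the block through [x] and [b_t].  Averaged over
   [b_t] a step halves the variance of the distribution of [w] exactly, so for
   [2^r >= n k] the pair [(b, w)] is uniform up to relative error [1 / sqrt k].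
   Hence, for every unit vector, the law of [v a_1 + .. + v a_r] shifted by it
   nearly equals the fixed law of [v b_1 + .. + v b_r + v w].  Edge-isoperimetry
   in [F_2^k], applied to the union of these two multisets of [n^(r+1)] points,
   gives [k - sqrt k <= 1 + (r + 1) log_2 n] with [r <= log_2 n + log_2 k + 1],
   i.e. [log_2 n >= sqrt k - log_2 k - 3]. *)

Set Implicit Arguments.
Unset Strict Implicit.
Unset Printing Implicit Defensive.

Import Order.TTheory GRing.Theory Num.Theory.
Import numFieldNormedType.Exports.

Local Open Scope ring_scope.

(** * Blocks of a design as ordered quadruples *)

Section Design.
Variables (n : nat) (H : {set {set 'I_n}}).
Hypothesis HD : is_design H.

(** The listing is ordered, so a pair of distinct points extends in two ways; this is the factor 2
    in [sum_quad_tail]. *)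
Definition quad (i a b c : 'I_n) : bool :=
  uniq [:: i; a; b; c] &&
  [exists C in H, [&& i \in C, a \in C, b \in C & c \in C]].

(** Three distinct points of a common block; the witness [a] is the fourth point, which the other
    three determine by [quad_inj]. *)
Definition coblock (b w c : 'I_n) : bool := [exists a, quad w a b c].

Lemma quadP (i a b c : 'I_n) :
  reflect (uniq [:: i; a; b; c] /\
    exists2 C, C \in H & [/\ i \in C, a \in C, b \in C & c \in C])
  (quad i a b c).
Proof.
apply: (iffP andP) => [[u /exists_inP[C CH /and4P[]]]|[u [C CH [iC aC bC cC]]]].
  by split=> //; exists C.
by split=> //; apply/exists_inP; exists C => //; apply/and4P.
Qed.

Lemma block_eq (u v : 'I_n) (C D : {set 'I_n}) : u != v ->
  C \in H -> D \in H -> u \in C -> v \in C -> u \in D -> v \in D -> C = D.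
Proof.
case: HD => _ H2 uv CH DH uC vC uD vD.
have [E [_ uniqE]] := H2 u v uv.
by rewrite -(uniqE C) // -(uniqE D).
Qed.

(** The block through [i] and [a] is unique and has four points; deleting these two leaves [x] and
    [y], listed in either order. *)
Lemma quad_tail (i a : 'I_n) : i != a ->
  exists x y, x != y /\ forall b c,
    quad i a b c = ((b == x) && (c == y)) || ((b == y) && (c == x)).
Proof.
move=> ia; case: (HD) => H4 H2; have [C [[CH [iC aC]] _]] := H2 i a ia.
have aCi : a \in C :\ i by rewrite !inE eq_sym ia.
have : #|C :\ i :\ a| == 2%N.
  by move: (H4 C CH); rewrite (cardsD1 i) iC (cardsD1 a) aCi !add1n => -[->].
move=> /cards2P[x [y [xy Cxy]]]; exists x, y; split=> // b c.
have -> : quad i a b c = [&& b \in [set x; y], c \in [set x; y] & b != c].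
  rewrite -Cxy !inE; apply/quadP/idP => [[/and4P[] /=]|].
    rewrite !inE !negb_or !(eq_sym i) !(eq_sym a).
    move=> /and3P[_ -> ->] /andP[-> ->] -> _ [D DH [iD aD bD cD]].
    by rewrite (block_eq ia CH DH) // bD cD.
  case/and3P => /and3P[ba bi bC] /and3P[ca ci cC] bc; split; last by exists C.
  by rewrite /= !inE !negb_or ia bc !(eq_sym i) !(eq_sym a) ba bi ca ci.
rewrite !inE.
have [->|bx] := eqVneq b x.
  rewrite (negbTE xy) /= orbF (eq_sym x).
  by have [->|] := eqVneq c x; rewrite /= ?(negbTE xy) ?andbT.
have [->|] //= := eqVneq b y.
rewrite (eq_sym y); have [->|] := eqVneq c y; rewrite /= ?orbF ?andbT //.
by rewrite orbT (eq_sym y) (negbTE xy).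
Qed.

Lemma quad_neq i a b c : quad i a b c -> i != a.
Proof. by case/quadP => /=; rewrite !inE !negb_or => /andP[/and3P[]]. Qed.

Lemma sum_quad_tail (V : nmodType) i a (z : V) :
  \sum_b \sum_c z *+ quad i a b c = (z *+ (i != a)) *+ 2.
Proof.
have [->|ia] /= := eqVneq i a.
  rewrite mulr0n mul0rn big1 // => b _; rewrite big1 // => c _.
  by case: (boolP (quad _ _ _ _)) => // /quad_neq; rewrite eqxx.
have [x [y [xy qE]]] := quad_tail ia.
have yx : y != x by rewrite eq_sym.
rewrite (bigD1 x) //= [X in _ + X](bigD1 y) //= [X in _ + (_ + X)]big1 => [|b /andP[bx bY]].
  rewrite (bigD1 y) //= big1 => [|c cy]; last first.
    by rewrite qE (negbTE cy) (negbTE xy) !andbF.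
  rewrite (bigD1 x) //= big1 => [|c cx]; last first.
    by rewrite qE (negbTE cx) (negbTE yx) !andbF.
  by rewrite !qE !eqxx orbT /= !addr0.
by rewrite big1 // => c _; rewrite qE (negbTE bx) (negbTE bY).
Qed.

Lemma quad_perm i a b c i' a' b' c' :
  perm_eq [:: i; a; b; c] [:: i'; a'; b'; c'] ->
  quad i a b c = quad i' a' b' c'.
Proof.
move=> pe; congr andb; first exact: perm_uniq.
apply: eq_existsb => C; congr andb.
by have := perm_all (mem C) pe; rewrite /= !andbT.
Qed.

Lemma quadC12 i a b c : quad i a b c = quad a i b c.
Proof. by apply/quad_perm/permEl; exact: (perm_catCA [:: i] [:: a]). Qed.

Lemma quadC23 i a b c : quad i a b c = quad i b a c.
Proof.
apply/quad_perm; rewrite perm_cons; apply/permEl.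
exact: (perm_catCA [:: a] [:: b]).
Qed.

Lemma quad_inj a a' w b c : quad w a b c -> quad w a' b c -> a = a'.
Proof.
rewrite !(quadC23 w _ b c) => qa; have wb := quad_neq qa.
have [x [y [xy qE]]] := quad_tail wb; move: qa; rewrite !qE.
by case/orP => /andP[/eqP-> /eqP->]; rewrite eqxx ?(eq_sym y) (negbTE xy)
  andbT andbF ?orbF /= => /eqP.
Qed.

Lemma sum_quad_coblock (V : nmodType) b w c (z : V) :
  \sum_a z *+ quad w a b c = z *+ coblock b w c.
Proof.
rewrite /coblock; case: existsP => [[a qa]|nq]; last first.
  rewrite big1 // => a _; case: (boolP (quad w a b c)) => // qa.
  by case: nq; exists a.
rewrite (bigD1 a) //= qa big1 ?addr0 // => a' aa'.
case: (boolP (quad w a' b c)) => // qa'.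
by rewrite (quad_inj qa' qa) eqxx in aa'.
Qed.

(** Both blocks contain the pair [b], [c], hence coincide and consist of these four points. *)
Lemma coblock_mul b c w1 w2 : w1 != w2 ->
  coblock b w1 c && coblock b w2 c = quad w1 w2 b c.
Proof.
move=> w12; apply/andP/idP => [[/existsP[a1 q1] /existsP[a2 q2]]|q]; last first.
  by split; apply/existsP; [exists w2 | exists w1; rewrite -quadC12].
case/quadP: q1 => [/and4P[]]; rewrite /= !inE !negb_or.
move=> /and3P[_ w1b w1c] _ bc _ [C CH [w1C _ bC cC]].
case/quadP: q2 => [/and4P[]]; rewrite /= !inE !negb_or.
move=> /and3P[_ w2b w2c] _ _ _ [D DH [w2D _ bD cD]].
apply/quadP; split; first by rewrite /= !inE !negb_or w12 w1b w1c w2b w2c bc.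
by exists C => //; split=> //; rewrite (block_eq bc CH DH).
Qed.

Lemma quad_sum (V : nmodType) (f : 'I_n -> V) i a b c : quad i a b c ->
  exists2 C, C \in H & \sum_(x in C) f x = f i + f a + (f b + f c).
Proof.
case: HD => H4 _ /quadP[u [C CH [iC aC bC cC]]]; exists C => //.
have sub : {subset [:: i; a; b; c] <= enum C}.
  by apply/allP; rewrite /= !mem_enum iC aC bC cC.
have sz : (size (enum C) <= size [:: i; a; b; c])%N by rewrite -cardE H4.
have [_ eqC] := uniq_min_size u sub sz.
rewrite (eq_bigl [in [:: i; a; b; c]]) => [|x]; last by rewrite /= eqC mem_enum.
by rewrite -big_uniq //= !big_cons big_nil addr0 !addrA.
Qed.

(** * One step of the random walk and its Gram matrix *)

Section Kernel.
Variable R : realFieldType.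

(* Fixing [b] makes [b] absorbing: this matches the degenerate choice [a = i] in
   [kernel_transfer], where the sum [v i + v a] vanishes. *)
Definition kernel (b w c : 'I_n) : R :=
  ((b == w) && (b == c))%:R + (coblock b w c)%:R / 2.

Lemma sum_diag (w : 'I_n) (F : 'I_n -> 'I_n -> R) :
  \sum_b \sum_c ((b == w) && (b == c))%:R * F b c = F w w.
Proof.
rewrite (bigD1 w) //= (bigD1 w) //= !eqxx mul1r !big1 ?addr0 // => [b bw|c cw].
  by rewrite big1 // => c _; rewrite (negbTE bw) mul0r.
by rewrite (eq_sym w) (negbTE cw) mul0r.
Qed.

Lemma sum_coblock (w : 'I_n) (F : 'I_n -> 'I_n -> R) :
  \sum_b \sum_c (coblock b w c)%:R * F b c =
  \sum_a \sum_b \sum_c F b c *+ quad w a b c.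
Proof.
rewrite [RHS]exchange_big; apply: eq_bigr => b _.
rewrite [RHS]exchange_big; apply: eq_bigr => c _ /=.
by rewrite sum_quad_coblock mulr_natl.
Qed.

(** For [a != i] the term is split evenly between the two orders of the remaining pair of the block;
    the term [a = i] is [Phi 0], which the diagonal part of the kernel supplies at [b = c = i]. *)
Lemma kernel_transfer (W : zmodType) (v : 'I_n -> W) (Phi : W -> R) (i : 'I_n) :
  (forall j, v j + v j = 0) ->
  (forall j a b c, quad j a b c -> v j + v a = v b + v c) ->
  \sum_a Phi (v i + v a) = \sum_b \sum_c kernel b i c * Phi (v b + v c).
Proof.
move=> v2 vq; transitivity (Phi 0 +
    \sum_a \sum_b \sum_c (Phi (v b + v c) / 2) *+ quad i a b c).
  transitivity (Phi 0 + \sum_a (Phi (v i + v a) / 2) *+ (i != a) *+ 2).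
    rewrite [LHS](bigD1 i) //= v2; congr (_ + _).
    rewrite [RHS](bigD1 i) //= eqxx mulr0n mul0rn add0r.
    apply: eq_bigr => a ai; rewrite eq_sym ai mulr1n; lra.
  congr (_ + _); apply: eq_bigr => a _; rewrite -sum_quad_tail.
  apply: eq_bigr => b _; apply: eq_bigr => c _.
  by case: (boolP (quad i a b c)) => // /vq->.
rewrite -sum_coblock -(v2 i) -(sum_diag i (fun b c => Phi (v b + v c))).
rewrite -big_split; apply: eq_bigr => b _ /=.
rewrite -big_split; apply: eq_bigr => c _ /=.
by rewrite mulrDl -mulrA (mulrC 2^-1).
Qed.

Lemma kernel_mass b w : \sum_c kernel b w c = 1.
Proof.
rewrite big_split /= -mulr_suml.
under [X in _ + X / _]eq_bigr => c _ do rewrite -sum_quad_coblock.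
rewrite exchange_big /=.
under [X in _ + X / _]eq_bigr => a _ do
  under eq_bigr => c _ do rewrite (quadC23 w a b c).
rewrite sum_quad_tail (eq_sym w).
have [_|bw] := eqVneq b w; last first.
  by rewrite /= big1 // add0r mulr1n mulfV // pnatr_eq0.
rewrite mulr0n mul0rn mul0r addr0 (bigD1 b) //= eqxx big1 ?addr0 // => c cb.
by rewrite eq_sym (negbTE cb).
Qed.

Lemma coblock_neq b w c : coblock b w c -> [&& b != w, b != c & w != c].
Proof.
case/existsP => a /quadP[/and4P[] /=]; rewrite !inE !negb_or.
by rewrite (eq_sym b w) => /and3P[_ -> ->] _ -> _ _.
Qed.

(** For [w1 != w2] only the two orders of the rest of their block contribute, [1 / 4] each. For
    [w1 = w2] the diagonal part gives 1 and the [2 (n - 1)] ordered tails give [1 / 4] each. A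
    constant plus a multiple of the identity is what makes the variance recursion exact. *)
Lemma kernel_gram w1 w2 :
  \sum_b \sum_c kernel b w1 c * kernel b w2 c =
  1 / 2 + (n%:R / 2) *+ (w1 == w2).
Proof.
transitivity ((w1 == w2)%:R + (\sum_b \sum_c
    (coblock b w1 c && coblock b w2 c)%:R : R) / 4).
  rewrite -(sum_diag w1 (fun b c => (b == w2)%:R)) mulr_suml -big_split.
  apply: eq_bigr => b _ /=; rewrite mulr_suml -big_split; apply: eq_bigr => c _ /=.
  rewrite /kernel.
  (* The two parts of the kernel have disjoint supports, so the cross terms vanish. *)
  have coF w : coblock b w c -> ((b == w) = false) * ((b == c) = false).
    by case/coblock_neq/and3P => /negbTE-> /negbTE->.
  case: (boolP (coblock b w1 c)) => [/coF E|_].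
    by case: (boolP (coblock b w2 c)) => _; rewrite !E ?andbF /=; lra.
  case: (boolP (coblock b w2 c)) => [/coF E|_]; first by rewrite !E ?andbF /=; lra.
  by case: (b == w1); case: (b == w2); case: (b == c) => /=; lra.
have [<-|w12] := eqVneq w1 w2; last first.
  under eq_bigr => b _ do under eq_bigr => c _ do rewrite coblock_mul //.
  by rewrite sum_quad_tail w12 /=; lra.
under eq_bigr => b _ do under eq_bigr => c _ do rewrite andbb -[_%:R]mulr1.
rewrite sum_coblock; under eq_bigr => a _ do rewrite sum_quad_tail.
rewrite (bigD1 w1) //= eqxx mulr0n mul0rn add0r.
under eq_bigr => a aw do rewrite eq_sym aw.
rewrite sumr_const cardC1 card_ord /=.
case: (n) w1 => [[]//|m] _; rewrite /= -natr1 -[_ *+ m]mulr_natl; lra.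
Qed.

End Kernel.
End Design.

(** * Words, and the variance of the [r]-step walk *)

(** Nested pairs rather than tuples, so that head and tail are projections and sums over words split
    by [pair_big]. *)
Fixpoint word (T : finType) (r : nat) : finType :=
  if r is r'.+1 then (T * word T r')%type else unit.

Lemma card_word (T : finType) r : #|word T r| = (#|T| ^ r)%N.
Proof. by elim: r => [|r IH]; rewrite ?card_unit //= card_prod IH expnS. Qed.

Lemma sum_wordS (V : nmodType) (T : finType) r (F : T -> word T r -> V) :
  \sum_(a : word T r.+1) F a.1 a.2 = \sum_x \sum_(a : word T r) F x a.
Proof. by rewrite pair_big. Qed.

Fixpoint word_sum (T : finType) (W : zmodType) (v : T -> W) (r : nat) :
    word T r -> W :=
  if r is r'.+1 then fun a => v a.1 + word_sum v a.2 else fun _ => 0.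

Section Walk.
Variables (n : nat) (H : {set {set 'I_n}}) (R : realFieldType).
Hypothesis HD : is_design H.

(* [walk i b w] is the probability of ending at [w]; the head of [b] drives the
   last step. *)
Fixpoint walk (i : 'I_n) (r : nat) : word 'I_n r -> 'I_n -> R :=
  if r is r'.+1 then
    fun b w => \sum_w1 walk i b.2 w1 * kernel H R b.1 w1 w
  else fun _ w => (w == i)%:R.

(** Induction on [r]: the head [x] is set aside as a translation while the tail is transferred,
    leaving [v w + v x], to which [kernel_transfer] applies. *)
Lemma walk_transfer (W : zmodType) (v : 'I_n -> W) (i : 'I_n) r (Phi : W -> R) :
  (forall j, v j + v j = 0) ->
  (forall j a b c, quad H j a b c -> v j + v a = v b + v c) ->
  \sum_(a : word 'I_n r) Phi (v i + word_sum v a) =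
  \sum_(b : word 'I_n r) \sum_w walk i b w * Phi (word_sum v b + v w).
Proof.
move=> v2 vq; elim: r Phi => [|r IH] Phi /=.
  rewrite !(big_pred1 tt) /=; try by case.
  rewrite (bigD1 i) //= eqxx mul1r big1 ?addr0 ?add0r // => w wi.
  by rewrite (negbTE wi) mul0r.
rewrite (sum_wordS (fun x a => Phi (v i + (v x + word_sum v a)))).
rewrite (sum_wordS (fun x b => \sum_w (\sum_w1 walk i b w1 * kernel H R x w1 w)
  * Phi (v x + word_sum v b + v w))).
transitivity (\sum_x \sum_(b : word 'I_n r) \sum_w walk i b w *
    Phi (word_sum v b + (v w + v x))).
  apply: eq_bigr => x _; rewrite -(eq_bigr _ (fun b _ => eq_bigr _ (fun w _ =>
    congr1 (fun z => walk i b w * Phi z) (esym (addrA _ _ _))))).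
  rewrite -(IH (fun z => Phi (z + v x))).
  by apply: eq_bigr => a _; rewrite -addrA (addrC (v x)).
rewrite exchange_big [RHS]exchange_big; apply: eq_bigr => b _ /=.
rewrite exchange_big /=.
transitivity (\sum_w1 walk i b w1 * \sum_x \sum_w kernel H R x w1 w *
    Phi (word_sum v b + (v x + v w))).
  apply: eq_bigr => w1 _.
  by rewrite -mulr_sumr (kernel_transfer HD (fun z => Phi (word_sum v b + z)) _ v2).
under [LHS]eq_bigr => w1 _ do rewrite mulr_sumr.
rewrite exchange_big; apply: eq_bigr => x _ /=.
under [LHS]eq_bigr => w1 _ do rewrite mulr_sumr.
rewrite exchange_big; apply: eq_bigr => w _ /=.
rewrite mulr_suml; apply: eq_bigr => w1 _.
by rewrite mulrA addrA (addrC (v x)).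
Qed.

Lemma walk_mass i r (b : word 'I_n r) : \sum_w walk i b w = 1.
Proof.
elim: r b => [|r IH] b /=.
  rewrite (bigD1 i) //= eqxx big1 ?addr0 // => w wi.
  by rewrite (negbTE wi).
rewrite exchange_big -(IH b.2); apply: eq_bigr => w1 _.
by rewrite -mulr_sumr kernel_mass // mulr1.
Qed.

(** Expanding the square and summing over the head letter produces the Gram matrix: its constant
    part meets the squared mass 1, its identity part the previous energy. *)
Lemma walk_energyS i r :
  \sum_(b : word 'I_n r.+1) \sum_w walk i b w ^+ 2 =
  n%:R / 2 * (\sum_(b : word 'I_n r) \sum_w walk i b w ^+ 2) + n%:R ^+ r / 2.
Proof.
rewrite /= (sum_wordS (fun x b =>
  \sum_w (\sum_w1 walk i b w1 * kernel H R x w1 w) ^+ 2)).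
rewrite exchange_big mulr_sumr /=.
have -> : n%:R ^+ r / 2 = \sum_(b : word 'I_n r) (1 / 2 : R).
  by rewrite sumr_const card_word card_ord -[RHS]mulr_natl natrX mul1r.
rewrite -big_split; apply: eq_bigr => b _ /=.
transitivity (\sum_w1 \sum_w2 walk i b w1 * walk i b w2 *
    \sum_x \sum_w kernel H R x w1 w * kernel H R x w2 w).
  transitivity (\sum_x \sum_w1 \sum_w2 \sum_w
      walk i b w1 * kernel H R x w1 w * (walk i b w2 * kernel H R x w2 w)).
    apply: eq_bigr => x _.
    under eq_bigr => w _ do rewrite expr2 big_distrlr /=.
    rewrite exchange_big; apply: eq_bigr => w1 _ /=.
    by rewrite exchange_big.
  rewrite exchange_big; apply: eq_bigr => w1 _ /=.
  rewrite exchange_big; apply: eq_bigr => w2 _ /=.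
  rewrite mulr_sumr; apply: eq_bigr => x _; rewrite mulr_sumr.
  by apply: eq_bigr => w _; rewrite mulrACA.
transitivity ((\sum_w1 walk i b w1) * (\sum_w2 walk i b w2) / 2 +
    n%:R / 2 * \sum_w walk i b w ^+ 2); last by rewrite !walk_mass addrC mul1r.
rewrite !mulr_suml mulr_sumr -big_split; apply: eq_bigr => w1 _ /=.
under eq_bigr => w2 _ do rewrite kernel_gram // mulrDr.
rewrite big_split /= mulr_sumr mulr_suml; congr (_ + _).
  by apply: eq_bigr => w2 _; rewrite mul1r.
rewrite (bigD1 w1) //= eqxx big1 ?addr0 => [|w2 w21]; last first.
  by rewrite eq_sym (negbTE w21) mulr0.
by rewrite mulr1n mulrC expr2.
Qed.

(** Relative to [n ^ r], the value for uniform endpoints, the excess starts at [n - 1] and halves at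
    each step. *)
Lemma walk_energy i r :
  n%:R * \sum_(b : word 'I_n r) \sum_w walk i b w ^+ 2 =
  n%:R ^+ r * ((n%:R - 1) / 2 ^+ r + 1).
Proof.
elim: r => [|r IH].
  rewrite (big_pred1 tt) /=; last by case.
  rewrite (bigD1 i) //= eqxx big1 ?addr0 => [|w wi]; last first.
    by rewrite (negbTE wi) expr0n.
  by rewrite !expr0 expr1n; field.
rewrite walk_energyS mulrDr mulrCA IH !exprS; field.
by rewrite expf_neq0 // pnatr_eq0.
Qed.

(** As the mass is 1, the left side is exactly the excess energy [n ^ r.+1 * (n - 1) / 2 ^ r]; the
    bound rounds [n - 1] up to [n]. *)
Lemma walk_deviation i r :
  \sum_(b : word 'I_n r) \sum_w (n%:R * walk i b w - 1) ^+ 2 <=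
  n%:R ^+ r.+2 / 2 ^+ r.
Proof.
have -> : \sum_(b : word 'I_n r) \sum_w (n%:R * walk i b w - 1) ^+ 2 =
    n%:R * (n%:R * \sum_(b : word 'I_n r) \sum_w walk i b w ^+ 2) - n%:R ^+ r.+1.
  have -> : n%:R ^+ r.+1 = \sum_(b : word 'I_n r) (n%:R : R).
    by rewrite sumr_const card_word card_ord -[RHS]mulr_natr natrX exprS.
  rewrite !mulr_sumr -sumrB; apply: eq_bigr => b _.
  transitivity (\sum_w (n%:R * (n%:R * walk i b w ^+ 2) -
      2 * n%:R * walk i b w + 1)); first by apply: eq_bigr => w _; ring.
  rewrite big_split sumrB /= -!mulr_sumr walk_mass sumr_const card_ord.
  rewrite -[1 *+ n]/(n%:R); ring.
rewrite walk_energy !exprS -subr_ge0.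
have -> : n%:R * (n%:R * n%:R ^+ r) / 2 ^+ r -
    (n%:R * (n%:R ^+ r * ((n%:R - 1) / 2 ^+ r + 1)) - n%:R * n%:R ^+ r)
    = n%:R * n%:R ^+ r / 2 ^+ r :> R.
  by field; rewrite expf_neq0 // pnatr_eq0.
by rewrite divr_ge0 ?mulr_ge0 ?exprn_ge0.
Qed.

End Walk.

(** * The two-point entropy inequality *)

Lemma ln_tangent (R : realType) (x : R) : 0 < x -> 1 - x^-1 <= ln x.
Proof.
move=> x0; have : ln (1 + (x^-1 - 1)) <= x^-1 - 1.
  by apply: le_ln1Dx; rewrite ltrBrDr addNr invr_gt0.
by rewrite addrC subrK lnV ?posrE //; lra.
Qed.

(* With [q = a / (a + b)] this is the entropy bound [h q >= 2 q ln 2], [q <= 1/2]. *)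
Lemma ln_two_point (R : realType) (a b : R) : 0 <= a -> a <= b ->
  a * ln a + b * ln b + 2 * a * ln 2 <= (a + b) * ln (a + b).
Proof.
move=> a0 ab; have [->|an0] := eqVneq a 0.
  by rewrite !mulr0 !mul0r !add0r addr0.
have {an0}a0 : 0 < a by rewrite lt_def an0.
have b0 : 0 < b by exact: lt_le_trans ab.
have ln2 : 1 / 2 <= ln (2 : R) by have := @ln_tangent R 2 (ltr0Sn _ _); lra.
(* In terms of [t = b / a]: [2 ln 2 <= ln (1 + t) + t ln (1 + 1 / t)]. *)
set A := ln (1 + b / a); set B := ln (1 + a / b).
have ba0 : 0 < b / a by exact: divr_gt0.
have ab0 : 0 < a / b by exact: divr_gt0.
have lnA : ln (a + b) = ln a + A.
  by rewrite -lnM ?posrE ?addr_gt0 // mulrDr mulr1 mulrCA divff ?gt_eqF ?mulr1.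
have lnB : ln (a + b) = ln b + B.
  rewrite -lnM ?posrE ?addr_gt0 // mulrDr mulr1 mulrCA divff ?gt_eqF ?mulr1 //.
  by rewrite addrC.
suff : 2 * a * ln 2 <= a * A + b * B.
  have -> : (a + b) * ln (a + b) = a * (ln a + A) + b * (ln b + B).
    by rewrite -lnA -lnB mulrDl.
  rewrite !mulrDr; lra.
have B0 : 0 <= B by apply: ln_ge0; lra.
(* For [t >= 3] the term [ln (1 + t) >= ln 4] suffices alone. For [t < 3], [ln_tangent] at
   [(1 + t) / 2] and [(1 + 1 / t) / 2] loses [(b - a)^2 / (a + b)] in total, at most [(b - a) ln 2]
   because [(b - a) / (a + b) <= 1 / 2 <= ln 2]. *)
have [b3|b3] := leP (3 * a) b.
  have : 2 * ln 2 <= A.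
    rewrite mulr_natl -lnXn // ler_ln ?posrE; [|lra|lra].
    have : 3 <= b / a by rewrite ler_pdivlMr.
    lra.
  nra.
have lnBt : ln 2 + 1 - 2 / (1 + a / b) <= B.
  have := @ln_tangent R ((1 + a / b) / 2).
  rewrite ln_div ?posrE ?invf_div; [|lra|lra].
  by move=> /(_ _)-/(_ ltac:(lra)); rewrite -/B; lra.
have lnAt : ln 2 + 1 - 2 / (1 + b / a) <= A.
  have := @ln_tangent R ((1 + b / a) / 2).
  rewrite ln_div ?posrE ?invf_div; [|lra|lra].
  by move=> /(_ _)-/(_ ltac:(lra)); rewrite -/A; lra.
have E1 : 2 / (1 + a / b) = 2 * b / (a + b).
  by field; rewrite ?gt_eqF //; lra.
have E2 : 2 / (1 + b / a) = 2 * a / (a + b).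
  by field; rewrite ?gt_eqF //; lra.
rewrite E1 in lnBt; rewrite E2 in lnAt.
set u := (a + b)^-1 in lnAt lnBt.
have uE : (a + b) * u = 1 by rewrite divff // gt_eqF ?addr_gt0.
have u0 : 0 < u by rewrite invr_gt0 addr_gt0.
have bu : (b - a) * u <= 1 / 2.
  by rewrite ler_pdivrMr ?addr_gt0 //; lra.
have : a * (ln 2 + 1 - 2 * a * u) <= a * A by rewrite ler_pM2l.
have : b * (ln 2 + 1 - 2 * b * u) <= b * B by rewrite ler_pM2l.
have key : a * (1 - 2 * a * u) + b * (1 - 2 * b * u) = - ((b - a) * ((b - a) * u)).
  transitivity (a + b - 2 * (a * a + b * b) * u); first by ring.
  transitivity ((a + b) * ((a + b) * u) - 2 * (a * a + b * b) * u).
    by rewrite uE mulr1.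
  by ring.
have : (b - a) * ((b - a) * u) <= (b - a) * ln 2.
  by apply: ler_wpM2l; lra.
lra.
Qed.

(** * Edge-isoperimetry in the cube *)

Lemma sum_row_mx (V : nmodType) (T : finComNzRingType) k (F : 'rV[T]_k.+1 -> V) :
  \sum_x F x = \sum_(b : T) \sum_(y : 'rV[T]_k) F (row_mx (b%:M : 'rV_1) y).
Proof.
rewrite pair_big /= (reindex (fun p : T * 'rV[T]_k =>
  row_mx (p.1%:M : 'rV_1) p.2 : 'rV[T]_(1 + k))) //=.
exists (fun x : 'rV[T]_(1 + k) => (lsubmx x 0 0, rsubmx x)).
  by move=> [b y] _ /=; rewrite row_mxKl row_mxKr !mxE eqxx.
by move=> x _ /=; rewrite -mx11_scalar hsubmxK.
Qed.

Lemma delta_row_mx0 (T : pzRingType) k :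
  delta_mx 0 0 = row_mx (1%:M : 'rV[T]_1) (0 : 'rV[T]_k).
Proof.
have -> : (1%:M : 'rV[T]_1) = delta_mx 0 0.
  by apply/rowP => i; rewrite !mxE (ord1 i).
by rewrite -delta_mx_lshift; congr delta_mx; exact: val_inj.
Qed.

Lemma delta_row_mxS (T : pzRingType) k (j : 'I_k) :
  delta_mx 0 (lift 0 j) = row_mx (0%:M : 'rV[T]_1) (delta_mx 0 j : 'rV[T]_k).
Proof.
rewrite raddf0 -delta_mx_rshift; congr delta_mx; exact: val_inj.
Qed.

Section Isoperimetry.
Variable R : realType.

Lemma sum_F2 (F : 'F_2 -> R) : \sum_b F b = F 0 + F 1.
Proof.
rewrite (big_ord_recl 1) /= big_ord1; congr (F _ + F _); exact: val_inj.
Qed.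

(** A weighted form: for the indicator of a set [S] it bounds the ordered adjacent pairs in [S] by
    [|S| log_2 |S|]. Induction on [k] splits off the first coordinate; edges inside the halves are
    inductive, and those across are paid for by [ln_two_point]. *)
Lemma cube_isoperimetry k (c : 'rV['F_2]_k -> R) : (forall x, 0 <= c x) ->
  ln 2 * (\sum_j \sum_x Num.min (c x) (c (x + delta_mx 0 j))) +
    \sum_x c x * ln (c x) <=
  (\sum_x c x) * ln (\sum_x c x).
Proof.
elim: k c => [|k IH] c c0.
  rewrite big_ord0 mulr0 add0r.
  have E (F : 'rV['F_2]_0 -> R) : \sum_x F x = F 0.
    rewrite (bigD1 0) //= big1 ?addr0 // => x.
    by rewrite (thinmx0 x) eqxx.
  by rewrite !E.
pose d (b : 'F_2) y := c (row_mx (b%:M : 'rV_1) y).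
have d0 b y : 0 <= d b y by exact: c0.
rewrite big_ord_recl delta_row_mx0 !sum_row_mx !sum_F2 -/(d 0) -/(d 1).
have E0 b y : c (row_mx (b%:M : 'rV_1) y + row_mx 1%:M 0) = d (b + 1) y.
  by rewrite add_row_mx addr0 -raddfD.
have ES b y j : c (row_mx (b%:M : 'rV_1) y + row_mx 0%:M (delta_mx 0 j)) =
    d b (y + delta_mx 0 j).
  by rewrite add_row_mx -raddfD addr0.
have -> : \sum_(j < k) \sum_x Num.min (c x) (c (x + delta_mx 0 (lift 0 j))) =
    (\sum_j \sum_y Num.min (d 0 y) (d 0 (y + delta_mx 0 j))) +
    (\sum_j \sum_y Num.min (d 1 y) (d 1 (y + delta_mx 0 j))).
  rewrite -big_split; apply: eq_bigr => j _ /=.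
  rewrite delta_row_mxS sum_row_mx sum_F2.
  by congr (_ + _); apply: eq_bigr => y _; rewrite ES.
under eq_bigr => y _ do rewrite E0 add0r.
have F2 : 1 + 1 = 0 :> 'F_2 by exact: val_inj.
under [X in _ * (_ + X + _)]eq_bigr => y _ do rewrite E0 F2.
have := IH (d 0) (d0 0); have := IH (d 1) (d0 1).
set D0 := \sum_x d 0 x; set D1 := \sum_x d 1 x.
have D00 : 0 <= D0 by exact: sumr_ge0.
have D10 : 0 <= D1 by exact: sumr_ge0.
set m := \sum_y Num.min (d 0 y) (d 1 y).
set m' := \sum_y Num.min (d 1 y) (d 0 y).
have mm' : m' = m by apply: eq_bigr => y _; rewrite minC.
have m0 : m <= D0 by apply: ler_sum => y _; rewrite ge_min lexx.
have m1 : m <= D1 by apply: ler_sum => y _; rewrite ge_min lexx orbT.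
have ln2 : 0 <= ln (2 : R) by rewrite ln_ge0 // ler1n.
have : D0 * ln D0 + D1 * ln D1 + 2 * m * ln 2 <= (D0 + D1) * ln (D0 + D1).
  (* The crossing weight [m] is at most both masses, so the smaller mass can take the place of [a]
     in [ln_two_point]. *)
  have [D01|D10'] := leP D0 D1.
    apply: le_trans (ln_two_point D00 D01); rewrite lerD2l.
    by apply: ler_wpM2r => //; lra.
  rewrite (addrC D0) [X in X + _]addrC.
  apply: le_trans (ln_two_point D10 (ltW D10')); rewrite lerD2l.
  by apply: ler_wpM2r => //; lra.
rewrite mm' !mulrDr; lra.
Qed.

End Isoperimetry.

(** * Systematic form of the code *)

Lemma addvv_F2 k (x : 'rV['F_2]_k) : x + x = 0.
Proof.
apply/rowP => j; rewrite !mxE; move: (x 0 j) => y.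
by apply: val_inj; case: y => -[|[|]].
Qed.

(** A basis of the code, written as the columns of [A], has full rank, so some [k] rows are
    independent; multiplying by the inverse of that minor turns them into unit vectors and preserves
    the block relations. *)
Lemma systematic_columns n (H : {set {set 'I_n}}) : is_design H ->
  exists (v : 'I_n -> 'rV['F_2]_(\dim (lcc_space H)))
         (f : 'I_(\dim (lcc_space H)) -> 'I_n),
    (forall i a b c, quad H i a b c -> v i + v a = v b + v c) /\
    (forall j, v (f j) = delta_mx 0 j).
Proof.
move=> HD; set U := lcc_space H; set k := \dim U.
pose A : 'M['F_2]_(n, k) := \matrix_(i, j) (vbasis U)`_j 0 i.
have Afull : row_full A.
  rewrite /row_full -mxrank_tr; apply: inj_row_free => u uA0.
  have/freeP/(_ (fun j => u 0 j)) := basis_free (vbasisP U).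
  move=> uE; apply/rowP => j; rewrite mxE; apply: uE.
  apply/rowP => i; move/rowP/(_ i): uA0; rewrite !mxE summxE => uA0.
  by rewrite -[RHS]uA0; apply: eq_bigr => l _; rewrite !mxE.
pose f := fullrankfun Afull; pose N := invmx (rowsub f A).
exists (fun i => row i (A *m N)), f; split=> [i a b c|j]; last first.
  by rewrite -row_rowsub -mul_rowsub_mx mulmxV ?fullrowsub_unit // row1.
move=> /(quad_sum HD (fun i => row i A)) [C CH Csum].
have: row i A + row a A + (row b A + row c A) = 0.
  rewrite -Csum; apply/rowP => j; rewrite summxE !mxE.
  have : (vbasis U)`_j \in U by apply: vbasis_mem; rewrite mem_nth // size_tuple.
  rewrite mem_lcc_space => /forall_inP/(_ C CH)/eqP bj.
  by rewrite -[RHS]bj; apply: eq_bigr => l _; rewrite !mxE.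
move=> s0; rewrite !row_mul -!mulmxDl; congr (_ *m _).
by rewrite -[LHS]addr0 -(addvv_F2 (row b A + row c A)) addrA s0 add0r.
Qed.

(** * Overlap of the two multisets and the dimension bound *)

(** AM-GM for [1 - z]; it turns a variance bound into an overlap bound, with [s] free for
    balancing. *)
Lemma min1_ge (R : realFieldType) (s z : R) : 0 < s ->
  1 - (s^-1 + s * (z - 1) ^+ 2) / 2 <= Num.min z 1.
Proof.
move=> s0; have si0 : 0 < s^-1 by rewrite invr_gt0.
have sq : 0 <= s * (z - 1) ^+ 2 by rewrite mulr_ge0 ?sqr_ge0 // ltW.
rewrite le_min; apply/andP; split; last by lra.
have : 0 <= s^-1 * (s * (1 - z) - 1) ^+ 2 by rewrite mulr_ge0 ?sqr_ge0 // ltW.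
have -> : s^-1 * (s * (1 - z) - 1) ^+ 2 = s * (z - 1) ^+ 2 - 2 * (1 - z) + s^-1.
  by field; rewrite gt_eqF.
lra.
Qed.

Section Count.
Variables (R : realType) (n k r : nat) (H : {set {set 'I_n}}).
Variables (v : 'I_n -> 'rV['F_2]_k) (f : 'I_k -> 'I_n).
Hypothesis HD : is_design H.
Hypothesis vq : forall i a b c, quad H i a b c -> v i + v a = v b + v c.
Hypothesis vf : forall j, v (f j) = delta_mx 0 j.
Hypotheses (n0 : (0 < n)%N) (k0 : (0 < k)%N) (nkr : (n * k <= 2 ^ r)%N).

Let P (x : 'rV['F_2]_k) : R :=
  \sum_(a : word 'I_n r) (word_sum v a == x)%:R.
Let Q (x : 'rV['F_2]_k) : R :=
  \sum_(b : word 'I_n r) \sum_w (word_sum v b + v w == x)%:R.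
Let s : R := Num.sqrt k%:R.

Let s0 : 0 < s. Proof. by rewrite sqrtr_gt0 ltr0n. Qed.
Let ss : s * s = k%:R. Proof. by rewrite -expr2 sqr_sqrtr // ler0n. Qed.

Let sum_ind (T : finType) (y : T) : \sum_x (y == x)%:R = 1 :> R.
Proof.
rewrite (bigD1 y) //= eqxx big1 ?addr0 // => x xy.
by rewrite eq_sym (negbTE xy).
Qed.

Let sumP : \sum_x P x = n%:R ^+ r.
Proof.
rewrite exchange_big /=; under eq_bigr => a _ do rewrite sum_ind.
by rewrite sumr_const card_word card_ord natrX.
Qed.

Let sumQ : \sum_x Q x = n%:R ^+ r.+1.
Proof.
rewrite exchange_big /=; under eq_bigr => b _ do
  (rewrite exchange_big /=; under eq_bigr => w _ do rewrite sum_ind).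
under eq_bigr => b _ do rewrite sumr_const card_ord.
by rewrite sumr_const card_word card_ord -[LHS]mulr_natl natrX exprSr.
Qed.

Let P_shift (i : 'I_n) x : P x =
  \sum_(b : word 'I_n r) \sum_w walk H R i b w *
    (word_sum v b + v w == x + v i)%:R.
Proof.
rewrite -(@walk_transfer n H R HD _ v i r (fun z => (z == x + v i)%:R)) //; last first.
  by move=> j; exact: addvv_F2.
by apply: eq_bigr => a _; rewrite addrC (inj_eq (addIr _)).
Qed.

(** With [s = sqrt k] and mean square deviation at most [1 / k], each of the two error terms of
    [min1_ge] averages to at most [s^-1 / 2]. *)
Lemma overlap (j : 'I_k) :
  n%:R ^+ r.+1 * (1 - s^-1) <=
  \sum_x Num.min (n%:R * P x) (Q (x + delta_mx 0 j)).
Proof.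
pose g (b : word 'I_n r) w : R := Num.min (n%:R * walk H R (f j) b w) 1.
(* By [P_shift] both arguments of the minimum are sums over the same pairs [(b, w)], so the minimum
   dominates the sum of termwise minima; each pair hits exactly one [x]. *)
apply: (@le_trans _ R (\sum_(b : word 'I_n r) \sum_w g b w)); last first.
  have -> : \sum_(b : word 'I_n r) \sum_w g b w = \sum_x
      \sum_(b : word 'I_n r) \sum_w
        g b w * (word_sum v b + v w - delta_mx 0 j == x)%:R.
    rewrite [RHS]exchange_big; apply: eq_bigr => b _ /=.
    rewrite [RHS]exchange_big; apply: eq_bigr => w _ /=.
    by rewrite -mulr_sumr sum_ind mulr1.
  apply: ler_sum => x _; rewrite (P_shift (f j)) vf le_min !mulr_sumr.
  apply/andP; split; apply: ler_sum => b _; rewrite ?mulr_sumr;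
    apply: ler_sum => w _; rewrite subr_eq; case: eqP => _; rewrite ?mulr0 ?mulr1 //.
    by rewrite /g ge_min lexx.
  by rewrite /g ge_min lexx orbT.
have nr0 : 0 < n%:R ^+ r.+1 :> R by rewrite exprn_gt0 // ltr0n.
apply: (@le_trans _ R (\sum_(b : word 'I_n r) \sum_w
    (1 - (s^-1 + s * (n%:R * walk H R (f j) b w - 1) ^+ 2) / 2))); last first.
  by apply: ler_sum => b _; apply: ler_sum => w _; exact: min1_ge.
have -> : \sum_(b : word 'I_n r) \sum_w
    (1 - (s^-1 + s * (n%:R * walk H R (f j) b w - 1) ^+ 2) / 2) =
    n%:R ^+ r.+1 * (1 - s^-1 / 2) - s / 2 *
    \sum_(b : word 'I_n r) \sum_w (n%:R * walk H R (f j) b w - 1) ^+ 2.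
  have -> : n%:R ^+ r.+1 * (1 - s^-1 / 2) =
      \sum_(b : word 'I_n r) \sum_(w < n) (1 - s^-1 / 2).
    under eq_bigr => b _ do rewrite sumr_const card_ord.
    by rewrite sumr_const card_word card_ord -mulrnA -[RHS]mulr_natl natrM natrX exprS.
  rewrite mulr_sumr -sumrB; apply: eq_bigr => b _.
  rewrite mulr_sumr -sumrB; apply: eq_bigr => w _; ring.
(* Here [n k <= 2 ^ r] enters. *)
have dev : \sum_(b : word 'I_n r) \sum_w (n%:R * walk H R (f j) b w - 1) ^+ 2 <=
    n%:R ^+ r.+1 / k%:R.
  apply: le_trans (walk_deviation R HD (f j) r) _.
  rewrite exprSr -mulrA ler_pM2l // ler_pdivrMr ?exprn_gt0 //.
  rewrite mulrC ler_pdivlMr ?ltr0n // -natrX -natrM ler_nat //.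
have : s / 2 * \sum_(b : word 'I_n r) \sum_w (n%:R * walk H R (f j) b w - 1) ^+ 2
    <= n%:R ^+ r.+1 * (s^-1 / 2).
  apply: (@le_trans _ R (s / 2 * (n%:R ^+ r.+1 / k%:R))).
    by apply: ler_wpM2l dev; rewrite divr_ge0 ?ltW.
  rewrite -ss le_eqVlt; apply/orP; left; apply/eqP; field.
  by rewrite gt_eqF.
lra.
Qed.

Lemma dim_bound : (k%:R - s) * ln 2 <= ln 2 + r.+1%:R * ln n%:R.
Proof.
pose c x := n%:R * P x + Q x.
have P0 x : 0 <= P x by apply: sumr_ge0.
have Q0 x : 0 <= Q x by apply: sumr_ge0 => b _; apply: sumr_ge0.
have c0 x : 0 <= c x by rewrite addr_ge0 ?mulr_ge0.
have := cube_isoperimetry c0.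
have -> : \sum_x c x = 2 * n%:R ^+ r.+1.
  by rewrite big_split /= -mulr_sumr sumP sumQ exprS; ring.
have Nr0 : 0 < n%:R ^+ r.+1 :> R by rewrite exprn_gt0 // ltr0n.
(* The values of [c] are multiplicities, hence 0 or at least 1. *)
have clnc : 0 <= \sum_x c x * ln (c x).
  apply: sumr_ge0 => x _; have -> : c x = (n * \sum_(a : word 'I_n r)
      (word_sum v a == x) + \sum_(b : word 'I_n r) \sum_w
      ((word_sum v b + v w)%R == x))%N%:R.
    rewrite natrD natrM !natr_sum; congr (_ + _).
    by apply: eq_bigr => b _; rewrite natr_sum.
  case: (_ + _)%N => [|m]; first by rewrite mul0r.
  by rewrite mulr_ge0 // ln_ge0 // ler1n.
(* Each direction is counted twice: [P] at [x] against [Q] at the neighbour, and the reverse. *)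
have : k%:R * (2 * (n%:R ^+ r.+1 * (1 - s^-1))) <=
    \sum_(j < k) \sum_x Num.min (c x) (c (x + delta_mx 0 j)).
  rewrite -[in k%:R * _](card_ord k) mulr_natl -sumr_const.
  apply: ler_sum => j _.
  apply: (@le_trans _ R (\sum_x
    (Num.min (n%:R * P x) (Q (x + delta_mx 0 j)) +
     Num.min (Q x) (n%:R * P (x + delta_mx 0 j))))); last first.
    apply: ler_sum => x _; rewrite /c le_min.
    by apply/andP; split; [rewrite lerD // ge_min lexx|
      rewrite addrC lerD // ge_min lexx orbT].
  rewrite big_split mulr_natl mulr2n /= lerD ?overlap //.
  rewrite (reindex_inj (addIr (delta_mx 0 j))) /=.
  apply: (le_trans (overlap j)); apply: ler_sum => x _.
  by rewrite -addrA addvv_F2 addr0 minC.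
have l2 : 0 < ln (2 : R) by rewrite ln_gt0 // ltr1n.
rewrite lnM ?posrE // lnXn ?ltr0n // -[_ *+ r.+1]mulr_natl.
set S := \sum_(j < k) _; set L := _ + _ * ln n%:R => kS iso.
have : ln 2 * (k%:R * (2 * (n%:R ^+ r.+1 * (1 - s^-1)))) <= 2 * n%:R ^+ r.+1 * L.
  apply: (@le_trans _ R (ln 2 * S)); first by rewrite ler_pM2l.
  lra.
have -> : ln 2 * (k%:R * (2 * (n%:R ^+ r.+1 * (1 - s^-1)))) =
    2 * n%:R ^+ r.+1 * ((k%:R - s) * ln 2).
  by rewrite -ss; field; rewrite gt_eqF.
by rewrite ler_pM2l // mulr_gt0.
Qed.

End Count.

(** * Solving for [n] and the asymptotics *)

Lemma log_size_bound (R : realType) (n : nat) (H : {set {set 'I_n}}) :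
  is_design H -> (4 <= \dim (lcc_space H))%N ->
  (Num.sqrt (\dim (lcc_space H))%:R
    - (ln (\dim (lcc_space H))%:R / ln 2 + 3)) * ln 2 <= ln n%:R :> R.
Proof.
move=> HD k4; set k : R := (\dim (lcc_space H))%:R; have [v [f [vq vf]]] := systematic_columns HD.
have k0 : (0 < \dim (lcc_space H))%N by exact: leq_trans k4.
have n0 : (0 < n)%N by case: (f (Ordinal k0)) => i; exact: leq_trans.
have nk1 : (1 < n * \dim (lcc_space H))%N.
  by apply: leq_trans (leq_pmull _ n0); exact: leq_trans k4.
have [r [r0 rlt nkr]] : exists r, [/\ (0 < r)%N,
    (2 ^ r.-1 <= n * \dim (lcc_space H))%N & (n * \dim (lcc_space H) <= 2 ^ r)%N].
  (* The least admissible [r], so that [r <= log_2 n + log_2 k + 1]. *)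
  exists (up_log 2 (n * \dim (lcc_space H))).
  have /andP[/ltnW -> ->] := up_log_bounds (ltnSn 1) nk1.
  by rewrite up_log_gt0 nk1.
have := dim_bound R HD vq vf n0 k0 nkr; rewrite -/k.
have l2 : 0 < ln (2 : R) by rewrite ln_gt0 // ltr1n.
have n1 : 1 <= n%:R :> R by rewrite ler1n.
have k1 : 4 <= k by rewrite ler_nat.
have rle : r%:R * ln 2 <= ln n%:R + ln k + ln (2 : R).
  have nk0 : 0 < n%:R * k by rewrite mulr_gt0; lra.
  have : (r.-1)%:R * ln 2 <= ln (n%:R * k).
    rewrite mulr_natl -lnXn // ler_ln ?posrE ?exprn_gt0 //.
    by rewrite -natrX -natrM ler_nat.
  rewrite lnM ?posrE; [|lra|lra].
  have -> : r%:R = r.-1%:R + 1 :> R by rewrite natr1 prednK.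
  lra.
set s := Num.sqrt k; set L := ln n%:R; set l := ln (2 : R) in l2 rle *.
have s2 : 2 <= s.
  have -> : 2 = Num.sqrt (2 ^+ 2) :> R by rewrite sqrtr_sqr ger0_norm.
  by rewrite ler_wsqrtr //; lra.
have ss : s * s = k by rewrite -expr2 sqr_sqrtr //; lra.
have L0 : 0 <= L by rewrite ln_ge0.
have lk : 0 <= ln k by rewrite ln_ge0 //; lra.
rewrite -natr1 -[X in X - _]ss => bnd; rewrite leNgt; apply/negP => Lt.
(* In base 2, assuming [y < s - (m + 3)], the dimension bound gives
   [s (s - 1) <= 1 + (s - 1) (s - m - 3)], that is [(m + 3) (s - 1) <= 1], impossible since
   [s >= 2]. *)
pose y := L / l; pose m := ln k / l.
have yE : L = y * l by rewrite /y divfK // gt_eqF.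
have mE : ln k = m * l by rewrite /m divfK // gt_eqF.
have y0 : 0 <= y by rewrite divr_ge0 // ltW.
have m0 : 0 <= m by rewrite divr_ge0 // ltW.
move: Lt; rewrite yE ltr_pM2r // -/m => Lt.
have rle' : r%:R <= y + m + 1.
  by rewrite -(ler_pM2r l2) !mulrDl -yE -mE mul1r.
have : s * s - s <= 1 + (r%:R + 1) * y.
  by rewrite -(ler_pM2r l2); move: bnd; rewrite yE; lra.
have : (r%:R + 1) * y <= (y + m + 2) * y by apply: ler_wpM2r => //; lra.
have : (y + m + 2) * y <= (s - 1) * (s - (m + 3)).
  by apply: ler_pM; lra.
nra.
Qed.

(** [ln u <= u - 1] at the fourth root of [x]; this growth rate makes [ln k / sqrt k] vanish. *)
Lemma ln_le_root4 (R : realType) (x : R) : 0 < x ->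
  ln x <= 4 * Num.sqrt (Num.sqrt x).
Proof.
move=> x0; set u := Num.sqrt (Num.sqrt x).
have u0 : 0 < u by rewrite !sqrtr_gt0.
have -> : x = u ^+ 4.
  by rewrite (exprM u 2 2) !sqr_sqrtr // ?sqrtr_ge0 // ltW.
rewrite lnXn // mulr_natl lerMn2r /=.
have := @le_ln1Dx R (u - 1).
rewrite (addrC 1) subrK => /(_ _)/le_trans -> //; lra.
Qed.

Local Open Scope classical_set_scope.

Theorem theorem1 (R : realType) :
  exists e : nat -> R,
    [/\ e =O_\oo (fun k : nat => ln (k%:R : R) / Num.sqrt (k%:R : R)),
        e k @[k --> \oo] --> (0 : R) &
        \forall k \near \oo,
          forall (n : nat) (H : {set {set 'I_n}}),
            is_design H -> \dim (lcc_space H) = k ->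
            (2 : R) `^ ((1 - e k) * Num.sqrt (k%:R : R)) <= n%:R].
Proof.
(* Chosen so that [(1 - e k) * sqrt k] is the exponent of [log_size_bound]. *)
exists (fun k => (ln k%:R / ln 2 + 3) / Num.sqrt k%:R).
have l2 : 0 < ln (2 : R) by rewrite ln_gt0 // ltr1n.
(* For [k >= 2], [ln k / ln 2 >= 1] absorbs the constant 3, whence the factor 4. *)
have eE k : (2 <= k)%N -> `|(ln k%:R / ln 2 + 3) / Num.sqrt k%:R| <=
    4 / ln 2 * `|ln k%:R / Num.sqrt k%:R| :> R.
  move=> k2; have lk : ln 2 <= ln (k%:R : R).
    by rewrite ler_ln ?posrE ?ltr0n ?ler_nat // (leq_trans _ k2).
  have lkl : 1 <= ln k%:R / ln (2 : R) by rewrite ler_pdivlMr // mul1r.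
  have s0 : 0 <= (Num.sqrt k%:R)^-1 :> R by rewrite invr_ge0 sqrtr_ge0.
  rewrite !ger0_norm ?mulr_ge0 //; try lra.
  rewrite mulrA ler_wpM2r //; lra.
split.
- apply/eqO_exP; exists (4 / ln 2); first by rewrite divr_gt0.
  near=> k; apply: eE; near: k; exact: nbhs_infty_ge.
- apply/cvgr0Pnorm_le => eps eps0.
  near=> k.
  have k2 : (2 <= k)%N by near: k; exact: nbhs_infty_ge.
  apply: le_trans (eE k k2) _.
  have k0 : 0 < k%:R :> R by rewrite ltr0n (leq_trans _ k2).
  have lnk := ln_le_root4 k0.
  set u := Num.sqrt (Num.sqrt k%:R) in lnk.
  have u0 : 0 < u by rewrite !sqrtr_gt0.
  have uu : u * u = Num.sqrt k%:R by rewrite -expr2 sqr_sqrtr // sqrtr_ge0.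
  (* With [u] the fourth root of [k], the target is [4 / ln 2 * (4 * u) <= eps * u^2], which fixes
     this threshold for [u]. *)
  have D0 : 0 < 16 / ln 2 / eps by rewrite !divr_gt0.
  have uD : 16 / ln 2 / eps <= u.
    have : (16 / ln 2 / eps) ^+ 4 <= k%:R.
      by near: k; exact: nbhs_infty_ger.
    rewrite -[X in _ <= X](_ : u ^+ 4 = _).
      by rewrite ler_pXn2r // nnegrE; exact: ltW.
    by rewrite (exprM u 2 2) !sqr_sqrtr // ?sqrtr_ge0 // ltW.
  have lk0 : 0 <= ln (k%:R : R) by rewrite ln_ge0 // ler1n (leq_trans _ k2).
  rewrite ger0_norm ?divr_ge0 ?sqrtr_ge0 // -uu mulrA ler_pdivrMr ?mulr_gt0 //.
  move: uD; rewrite ler_pdivrMr // => uD.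
  have : 4 / ln 2 * ln k%:R <= 4 / ln 2 * (4 * u).
    by rewrite ler_wpM2l // divr_ge0 // ltW.
  move/le_trans; apply.
  have -> : 4 / ln 2 * (4 * u) = 16 / ln 2 * u :> R by field; rewrite gt_eqF.
  by have -> : eps * (u * u) = u * eps * u; [ring | rewrite ler_pM2r].
- near=> k => n H HD dimk.
  have k4 : (4 <= k)%N by near: k; exact: nbhs_infty_ge.
  have := log_size_bound R HD; rewrite dimk => /(_ k4) /=.
  have s0 : 0 < Num.sqrt (k%:R : R).
    by rewrite sqrtr_gt0 ltr0n (leq_trans _ k4).
  set s := Num.sqrt k%:R in s0 *.
  move=> bnd; rewrite mulrBl mul1r divfK ?gt_eqF //.
  (* Comparing logarithms needs [n > 0]; as [k >= 4], the map [f] supplies a point. *)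
  have n0 : (0 < n)%N.
    case: n H HD dimk bnd => // H HD dimk _.
    have [v [f _]] := systematic_columns HD; rewrite dimk in f.
    have k0 : (0 < k)%N by exact: leq_trans k4.
    by case: (f (Ordinal k0)).
  by rewrite -ler_ln ?posrE ?powR_gt0 ?ltr0n // ln_powR.
Unshelve. all: by end_near.
Qed.
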